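(* The quotient group $QI(\mathbb{R}_+)/H$ is not locally indicable.
   Context: $\mathbb{R}_+=[0,\infty)$. $QI(\mathbb{R}_+)$ is the group (under composition) of quasi-isometries $\mathbb{R}_+\to\mathbb{R}_+$ modulo the relation of being at bounded distance (two maps $f,g$ are equivalent if $\sup_x|f(x)-g(x)|<\infty$); $[f]$ denotes the class of $f$. $H=\{[f]\in QI(\mathbb{R}_+):\lim_{x\to\infty}f(x)/x=1\}$, a normal subgroup of $QI(\mathbb{R}_+)$. A group is locally indicable if each of its finitely generated nontrivial subgroups admits a nontrivial homomorphism to $\mathbb{Z}$. *)

(* Defs.v *)
From HB Require Import structures.
From mathcomp Require Import all_boot all_order all_algebra.
From mathcomp Require Import all_classical all_reals all_analysis.
From mathcomp Require Import interval_inference ring lra.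

Set Implicit Arguments.
Unset Strict Implicit.
Unset Printing Implicit Defensive.

Import Order.TTheory GRing.Theory Num.Theory.
Import numFieldNormedType.Exports.

Local Open Scope classical_set_scope.

Section Groups.
Local Open Scope group_scope.
Local Open Scope quotient_scope.

Definition subgroup (G : groupType) (K : set G) : Prop := group_closed (mem K).

Definition gen_subgroup (G : groupType) (s : seq G) : set G :=
  smallest (@subgroup G) [set` s].

(* A homomorphism K -> Z is given as a function on G; only its restriction to K
   is meaningful. *)
Definition locally_indicable (G : groupType) : Prop :=
  forall K : set G, subgroup K ->
    (exists s : seq G, K = gen_subgroup s) ->
    K <> [set 1] ->
    exists phi : G -> int,
      {in K &, forall x y, phi (x * y) = (phi x + phi y)%R} /\
      exists2 x, x \in K & phi x != 0%R.

Record normal_subgroup (G : groupType) := NormalSubgroup {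
  nsub_set :> set G;
  nsub_group : subgroup nsub_set;
  nsub_conj : forall x y, x \in nsub_set -> x ^ y \in nsub_set }.

Section Quotient.
Variables (G : groupType) (N : normal_subgroup G).

Lemma nsub1 : 1 \in (N : set G).
Proof. by case: (nsub_group N). Qed.

Lemma nsubM x y : x \in (N : set G) -> y \in (N : set G) -> x * y \in (N : set G).
Proof. exact: (group_closedM (nsub_group N)). Qed.

Lemma nsubV x : x \in (N : set G) -> x^-1 \in (N : set G).
Proof. exact: (group_closedV (nsub_group N)). Qed.

Definition coset_eq : rel G := fun x y => x^-1 * y \in (N : set G).

Lemma coset_eq_refl : reflexive coset_eq.
Proof. by move=> x; rewrite /coset_eq mulVg nsub1. Qed.

Lemma coset_eq_sym : symmetric coset_eq.
Proof.
have h x y : coset_eq x y -> coset_eq y x.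
  by rewrite /coset_eq => /nsubV; rewrite invgM invgK.
by move=> x y; apply/idP/idP; apply: h.
Qed.

Lemma coset_eq_trans : transitive coset_eq.
Proof.
move=> y x z; rewrite /coset_eq => h1 h2.
by have := nsubM h1 h2; rewrite mulgA mulgK.
Qed.

Canonical coset_equiv := EquivRel coset_eq coset_eq_refl coset_eq_sym coset_eq_trans.

Definition quotient_group := {eq_quot coset_equiv}.
HB.instance Definition _ := Choice.on quotient_group.
HB.instance Definition _ := EqQuotient.on quotient_group.

Definition coset_class (x : G) : quotient_group := \pi x.

Lemma coset_classE x y : coset_class x = coset_class y <-> coset_eq x y.
Proof. by split => [/eqmodP|h]; [|apply/eqmodP]. Qed.

Lemma coset_class_repr (x : quotient_group) : coset_class (repr x) = x.
Proof. exact: reprK. Qed.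

Lemma coset_eqM x x' y y' :
  coset_eq x x' -> coset_eq y y' -> coset_eq (x * y) (x' * y').
Proof.
rewrite /coset_eq => h1 h2; have := nsubM (nsub_conj y h1) h2.
by rewrite conjgE !mulgA mulgK invgM.
Qed.

Lemma coset_eqV x x' : coset_eq x x' -> coset_eq x^-1 x'^-1.
Proof.
rewrite coset_eq_sym /coset_eq => h; have := nsub_conj x'^-1 h.
by rewrite conjgE !invgK !mulgA mulgV mul1g.
Qed.

Definition quo_one : quotient_group := coset_class 1.
Definition quo_inv (x : quotient_group) := coset_class (repr x)^-1.
Definition quo_mul (x y : quotient_group) := coset_class (repr x * repr y).

Lemma repr_coset_class x : coset_eq (repr (coset_class x)) x.
Proof. by apply/coset_classE; rewrite coset_class_repr. Qed.

Lemma quo_mulE x y : quo_mul (coset_class x) (coset_class y) = coset_class (x * y).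
Proof. by apply/coset_classE/coset_eqM; apply: repr_coset_class. Qed.

Lemma quo_invE x : quo_inv (coset_class x) = coset_class x^-1.
Proof. by apply/coset_classE/coset_eqV/repr_coset_class. Qed.

Lemma quo_mulA : associative quo_mul.
Proof.
move=> x y z; rewrite -(coset_class_repr x) -(coset_class_repr y).
by rewrite -(coset_class_repr z) !quo_mulE mulgA.
Qed.

Lemma quo_mul1 : left_id quo_one quo_mul.
Proof. by move=> x; rewrite -(coset_class_repr x) quo_mulE mul1g. Qed.

Lemma quo_mulr1 : right_id quo_one quo_mul.
Proof. by move=> x; rewrite -(coset_class_repr x) quo_mulE mulg1. Qed.

Lemma quo_mulV : left_inverse quo_one quo_inv quo_mul.
Proof. by move=> x; rewrite -(coset_class_repr x) quo_invE quo_mulE mulVg. Qed.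

Lemma quo_mulrV : right_inverse quo_one quo_inv quo_mul.
Proof. by move=> x; rewrite -(coset_class_repr x) quo_invE quo_mulE mulgV. Qed.

HB.instance Definition _ := isGroup.Build quotient_group
  quo_mulA quo_mul1 quo_mulr1 quo_mulV quo_mulrV.

Lemma coset_classM x y : coset_class (x * y) = coset_class x * coset_class y.
Proof. by rewrite -quo_mulE. Qed.

End Quotient.
End Groups.

Section QuasiIsometries.
Local Open Scope ring_scope.
Local Open Scope quotient_scope.
Variable R : realType.
Implicit Types f g h : {nonneg R} -> {nonneg R}.

Definition quasi_isometry f : Prop := exists K C : R,
  [/\ 1 <= K, 0 <= C,
   forall x y : {nonneg R},
     K^-1 * `|x%:num - y%:num| - C <= `|(f x)%:num - (f y)%:num|
       <= K * `|x%:num - y%:num| + C &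
   forall y : {nonneg R}, exists x : {nonneg R}, `|(f x)%:num - y%:num| <= C].

Definition bounded_dist f g : Prop :=
  exists M : R, forall x : {nonneg R}, `|(f x)%:num - (g x)%:num| <= M.

Lemma bounded_dist_refl f : bounded_dist f f.
Proof. by exists 0 => x; rewrite subrr normr0. Qed.

Lemma bounded_dist_sym f g : bounded_dist f g -> bounded_dist g f.
Proof. by move=> [M hM]; exists M => x; rewrite distrC. Qed.

Lemma bounded_dist_trans g f h :
  bounded_dist f g -> bounded_dist g h -> bounded_dist f h.
Proof.
move=> [M hM] [M' hM']; exists (M + M') => x.
by rewrite (le_trans (ler_distD (g x)%:num _ _))// lerD.
Qed.

Lemma quasi_isometry_id : quasi_isometry id.
Proof.
exists 1, 0; split => // [x y|y]; last by exists y; rewrite subrr normr0.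
by rewrite invr1 mul1r subr0 addr0 lexx.
Qed.

Lemma inv_ge1 (K : R) : 1 <= K -> [/\ 0 < K^-1, K^-1 <= 1 & K^-1 * K = 1].
Proof.
move=> K1; have K0 : 0 < K by apply: lt_le_trans K1.
by rewrite invr_gt0 K0 invf_le1 // K1 mulVf // gt_eqF.
Qed.

Lemma quasi_isometry_comp f g :
  quasi_isometry f -> quasi_isometry g -> quasi_isometry (f \o g).
Proof.
move=> [K [C [K1 C0 hf sf]]] [L [D [L1 D0 hg sg]]].
exists (K * L), (K * D + 2 * C); have [a0 a1 aK] := inv_ge1 K1.
have [b0 b1 bL] := inv_ge1 L1.
split; [by nra | by nra | move=> x y /= | move=> z].
  have /andP[f1 f2] := hf (g x) (g y); have /andP[g1 g2] := hg x y.
  rewrite invfM; apply/andP; split.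
    apply: le_trans f1.
    have : K^-1 * (L^-1 * `|x%:num - y%:num| - D) <= K^-1 * `|(g x)%:num - (g y)%:num|.
      by rewrite ler_pM2l.
    by nra.
  apply: (le_trans f2).
  have : K * `|(g x)%:num - (g y)%:num| <= K * (L * `|x%:num - y%:num| + D).
    by rewrite ler_pM2l //; lra.
  by nra.
have [y hy] := sf z; have [x hx] := sg y; exists x => /=.
apply: (le_trans (ler_distD (f y)%:num _ _)).
have /andP[_ f2] := hf (g x) y.
have : K * `|(g x)%:num - y%:num| <= K * D by rewrite ler_pM2l //; lra.
by lra.
Qed.

Lemma quasi_inverse f : quasi_isometry f -> exists g,
  [/\ quasi_isometry g, bounded_dist (g \o f) id & bounded_dist (f \o g) id].
Proof.
move=> [K [C [K1 C0 hf sf]]]; have [g hg] := choice sf.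
have [a0 a1 aK] := inv_ge1 K1.
have low x y : `|x%:num - y%:num| <= K * (`|(f x)%:num - (f y)%:num| + C).
  have /andP[f1 _] := hf x y.
  have : K * (K^-1 * `|x%:num - y%:num|) <= K * (`|(f x)%:num - (f y)%:num| + C).
    by rewrite ler_pM2l //; lra.
  by rewrite mulrA [K * _]mulrC aK mul1r.
have gf x : `|(g (f x))%:num - x%:num| <= 3 * K * C.
  apply: (le_trans (low _ _)); have := hg (f x) => h.
  have : K * (`|(f (g (f x)))%:num - (f x)%:num| + C) <= K * (C + C).
    by rewrite ler_pM2l ?lerD //; lra.
  by nra.
exists g; split; [|by exists (3 * K * C)|by exists C].
exists K, (3 * K * C); split => //; [by nra| |by move=> x; exists (f x); apply: gf].
move=> x y; have hx := hg x; have hy := hg y.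
have /andP[_ f2] := hf (g x) (g y).
have e1 : `|(f (g x))%:num - (f (g y))%:num| <= `|x%:num - y%:num| + 2 * C.
  apply: (le_trans (ler_distD x%:num _ _)).
  have := ler_distD y%:num x%:num (f (g y))%:num; rewrite (distrC y%:num).
  by lra.
have e2 : `|x%:num - y%:num| <= `|(f (g x))%:num - (f (g y))%:num| + 2 * C.
  apply: (le_trans (ler_distD (f (g x))%:num _ _)); rewrite (distrC x%:num).
  have := ler_distD (f (g y))%:num (f (g x))%:num y%:num.
  by lra.
apply/andP; split.
  have : K^-1 * `|x%:num - y%:num|
      <= K^-1 * (K * `|(g x)%:num - (g y)%:num| + 3 * C).
    by rewrite ler_pM2l //; lra.
  by rewrite mulrDr mulrA aK; nra.
apply: (le_trans (low _ _)).
have : K * (`|(f (g x))%:num - (f (g y))%:num| + C)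
    <= K * (`|x%:num - y%:num| + 2 * C + C).
  by rewrite ler_pM2l //; lra.
by nra.
Qed.

Definition qi_map := {f : {nonneg R} -> {nonneg R} | `[< quasi_isometry f >]}.
HB.instance Definition _ := Choice.on qi_map.
Definition qi_fun (f : qi_map) : {nonneg R} -> {nonneg R} := val f.
Coercion qi_fun : qi_map >-> Funclass.
Implicit Types u v w : qi_map.

Lemma qi_mapP u : quasi_isometry u. Proof. exact/asboolP/(valP u). Qed.

Definition QiMap f (qf : quasi_isometry f) : qi_map := exist _ f (asboolT qf).

Definition qi_id : qi_map := QiMap quasi_isometry_id.
Definition qi_comp u v : qi_map := QiMap (quasi_isometry_comp (qi_mapP u) (qi_mapP v)).

Lemma qi_inv_ex u :
  {v : qi_map | bounded_dist (v \o u) id /\ bounded_dist (u \o v) id}.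
Proof.
apply: cid; have [g [qg h1 h2]] := quasi_inverse (qi_mapP u).
by exists (QiMap qg).
Qed.
Definition qi_inv u : qi_map := projT1 (qi_inv_ex u).

Definition qi_equiv : rel qi_map := fun u v => `[< bounded_dist u v >].

Lemma qi_equiv_refl : reflexive qi_equiv.
Proof. by move=> u; apply/asboolP/bounded_dist_refl. Qed.

Lemma qi_equiv_sym : symmetric qi_equiv.
Proof. by move=> u v; apply/asboolP/asboolP => /bounded_dist_sym. Qed.

Lemma qi_equiv_trans : transitive qi_equiv.
Proof.
by move=> v u w /asboolP h1 /asboolP h2; apply/asboolP/(bounded_dist_trans h1 h2).
Qed.

Canonical qi_equivRel := EquivRel qi_equiv qi_equiv_refl qi_equiv_sym qi_equiv_trans.

Definition QI := {eq_quot qi_equivRel}.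
HB.instance Definition _ := Choice.on QI.
HB.instance Definition _ := EqQuotient.on QI.

Definition qi_class u : QI := \pi u.

Lemma qi_classE u v : qi_class u = qi_class v <-> bounded_dist u v.
Proof.
by split => [/eqmodP/asboolP//|h]; apply/eqmodP/asboolP.
Qed.

Lemma qi_class_repr (x : QI) : qi_class (repr x) = x.
Proof. exact: reprK. Qed.

Lemma repr_qi_class u : bounded_dist (repr (qi_class u)) u.
Proof. by apply/qi_classE; rewrite qi_class_repr. Qed.

Lemma bounded_dist_comp u f' g g' : bounded_dist u f' -> bounded_dist g g' ->
  bounded_dist (u \o g) (f' \o g').
Proof.
have [K [C [K1 C0 hf _]]] := qi_mapP u.
move=> [M hM] [D hD]; exists (K * D + C + M) => x /=.
apply: (le_trans (ler_distD (u (g' x))%:num _ _)).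
have /andP[_ f2] := hf (g x) (g' x); have h1 := hM (g' x).
have : K * `|(g x)%:num - (g' x)%:num| <= K * D by rewrite ler_pM2l //; lra.
by lra.
Qed.

Definition QI_mul (x y : QI) : QI := qi_class (qi_comp (repr x) (repr y)).
Definition QI_inv (x : QI) : QI := qi_class (qi_inv (repr x)).
Definition QI_one : QI := qi_class qi_id.

Lemma QI_mulE u v : QI_mul (qi_class u) (qi_class v) = qi_class (qi_comp u v).
Proof. by apply/qi_classE/bounded_dist_comp; apply: repr_qi_class. Qed.

Lemma QI_mulA : associative QI_mul.
Proof.
move=> x y z; rewrite -(qi_class_repr x) -(qi_class_repr y) -(qi_class_repr z).
by rewrite !QI_mulE; apply/qi_classE/bounded_dist_refl.
Qed.

Lemma QI_mul1 : left_id QI_one QI_mul.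
Proof.
by move=> x; rewrite -(qi_class_repr x) QI_mulE; apply/qi_classE/bounded_dist_refl.
Qed.

Lemma QI_mulr1 : right_id QI_one QI_mul.
Proof.
by move=> x; rewrite -(qi_class_repr x) QI_mulE; apply/qi_classE/bounded_dist_refl.
Qed.

Lemma QI_mulV : left_inverse QI_one QI_inv QI_mul.
Proof.
move=> x; rewrite -{2}(qi_class_repr x) QI_mulE; apply/qi_classE.
by rewrite /qi_inv; case: (qi_inv_ex _) => v [].
Qed.

Lemma QI_mulrV : right_inverse QI_one QI_inv QI_mul.
Proof.
move=> x; rewrite -{1}(qi_class_repr x) QI_mulE; apply/qi_classE.
by rewrite /qi_inv; case: (qi_inv_ex _) => v [].
Qed.

HB.instance Definition _ := isGroup.Build QI
  QI_mulA QI_mul1 QI_mulr1 QI_mulV QI_mulrV.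

Lemma qi_classM u v : qi_class (qi_comp u v) = (qi_class u * qi_class v)%g.
Proof. by rewrite -QI_mulE. Qed.

Lemma qi_classV u v : bounded_dist (u \o v) id -> (qi_class u)^-1%g = qi_class v.
Proof.
by move=> uv; apply: mulg1_eq; rewrite -qi_classM; apply/qi_classE.
Qed.

(* A real x is turned into a point of {nonneg R} as |x|, which is x itself for
   the large x that matter at +oo. *)
Definition asymp_id f : Prop := (f `|x|%:nng)%:num / x @[x --> +oo] --> (1 : R).

Definition H_set : set QI := [set qi_class f | f in [set f : qi_map | asymp_id f]].

Lemma asymp_idP f : asymp_id f <-> forall e : R, 0 < e ->
  exists A : R, forall x : {nonneg R}, A <= x%:num ->
    `|(f x)%:num - x%:num| <= e * x%:num.
Proof.
split => [h e e0|h].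
  have /cvgrPdist_le/(_ e e0) := h.
  move=> [A [_ hA]]; exists (Num.max (A + 1) 1) => x; rewrite ge_max => /andP[Ax x1].
  have := hA x%:num (lt_le_trans _ Ax); rewrite ltrDl => /(_ ltr01).
  have -> : `|x%:num|%:nng = x by apply: val_inj => /=; rewrite ger0_norm.
  have x0 : 0 < x%:num by apply: lt_le_trans x1.
  have -> : 1 - (f x)%:num / x%:num = (x%:num - (f x)%:num) / x%:num.
    by rewrite mulrBl divff // gt_eqF.
  by rewrite normrM normfV (gtr0_norm x0) ler_pdivrMr // distrC.
apply/cvgrPdist_le => e e0; have [A hA] := h e e0.
exists (Num.max A 1); split; first by rewrite num_real.
move=> x; rewrite gt_max => /andP[Ax x1].
have x0 : 0 < x by apply: lt_trans x1.
have yE : (`|x|%:nng : {nonneg R})%:num = x by rewrite /= gtr0_norm.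
move: (_%:nng) yE => y yE.
have -> : 1 - (f y)%:num / x = (x - (f y)%:num) / x.
  by rewrite mulrBl divff // gt_eqF.
rewrite normrM normfV (gtr0_norm x0) ler_pdivrMr // distrC -{1 2}yE.
by have := hA y; rewrite yE; apply; apply: ltW.
Qed.

Lemma asymp_id_bounded f g : bounded_dist f g -> asymp_id f -> asymp_id g.
Proof.
move=> [M hM] /asymp_idP hf; apply/asymp_idP => e e0.
have [A hA] := hf (e / 2) (divr_gt0 e0 (ltr0n _ 2)).
exists (Num.max A (2 * M / e)) => x; rewrite ge_max => /andP[/hA h].
rewrite ler_pdivrMr // => h'.
have := ler_distD (f x)%:num (g x)%:num x%:num; have := hM x.
by rewrite (distrC (g x)%:num (f x)%:num); lra.
Qed.

Lemma qi_growth u : exists L D : R, [/\ 0 < L, 0 <= D & forall x : {nonneg R},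
  x%:num <= L * ((u x)%:num + D) /\ (u x)%:num <= L * (x%:num + D)].
Proof.
have [K [C [K1 C0 hf _]]] := qi_mapP u; have [a0 a1 aK] := inv_ge1 K1.
pose z : {nonneg R} := NngNum (lexx (0 : R)); have z0 : z%:num = 0 by [].
have u0 : 0 <= (u z)%:num by [].
exists K, (C + (u z)%:num); split; [by lra | by lra |] => x.
have /andP[] := hf x z; rewrite z0 subr0 (ger0_norm (ge0 x)) => h1 h2; split.
  have ux0 : 0 <= (u x)%:num by [].
  have h3 : K^-1 * x%:num <= (u x)%:num + (C + (u z)%:num).
    have := ler_normB (u x)%:num (u z)%:num.
    by rewrite (ger0_norm u0) (ger0_norm ux0); lra.
  have : K * (K^-1 * x%:num) <= K * ((u x)%:num + (C + (u z)%:num)).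
    by rewrite ler_pM2l //; lra.
  by rewrite mulrA [K * _]mulrC aK mul1r.
have := ler_norm ((u x)%:num - (u z)%:num).
by nra.
Qed.

Lemma asymp_id_comp f g : asymp_id f -> asymp_id g -> asymp_id (f \o g).
Proof.
move=> /asymp_idP hf /asymp_idP hg; apply/asymp_idP => e e0.
pose d : R := Num.min (e / 3) (1 / 2).
have d0 : 0 < d by rewrite lt_min; apply/andP; split; lra.
have d1 : d <= e / 3 by rewrite ge_min lexx.
have d2 : d <= 1 / 2 by rewrite ge_min lexx orbT.
have [A hA] := hf d d0; have [B hB] := hg d d0.
exists (Num.max B (2 * A)) => x; rewrite ge_max => /andP[/hB h1 h2] /=.
have x0 : 0 <= x%:num by [].
have h3 : `|(g x)%:num - x%:num| <= 1 / 2 * x%:num by nra.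
have /andP[h4 h5] : x%:num - 1 / 2 * x%:num <= (g x)%:num <= x%:num + 1 / 2 * x%:num.
  by rewrite -ler_distl.
have h6 := hA (g x) ltac:(lra).
by have := ler_distD (g x)%:num (f (g x))%:num x%:num; nra.
Qed.

Lemma asymp_id_conj f u v : bounded_dist (v \o u) id -> asymp_id f ->
  asymp_id (v \o f \o u).
Proof.
move=> [M hM] /asymp_idP hf; apply/asymp_idP => e e0.
have [K [C [K1 C0 hv _]]] := qi_mapP v.
have [L [D [L0 D0 hu]]] := qi_growth u.
have KL0 : 0 < K * L by rewrite mulr_gt0 //; lra.
pose d := e / (2 * (K * L)).
have d0 : 0 < d by rewrite divr_gt0 // mulr_gt0.
have dE : d * (K * L) = e / 2 by rewrite /d; field; rewrite !gt_eqF //; lra.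
have [A hA] := hf d d0.
exists (Num.max (L * (A + D)) (2 / e * (C + M + e / 2 * D))) => x.
rewrite ge_max => /andP[h1 h2] /=; have [h3 h4] := hu x.
have h5 : A <= (u x)%:num.
  have : L * (A + D) <= L * ((u x)%:num + D) by apply: le_trans h3.
  by rewrite ler_pM2l // lerD2r.
have h6 := hA _ h5; have /andP[_ h7] := hv (f (u x)) (u x).
have h8 : K * `|(f (u x))%:num - (u x)%:num| <= e / 2 * (x%:num + D).
  rewrite -dE; have -> : d * (K * L) * (x%:num + D) = K * (d * (L * (x%:num + D))).
    by ring.
  rewrite ler_pM2l; last by lra.
  by apply: (le_trans h6); rewrite ler_pM2l.
have h9 : C + M + e / 2 * D <= e / 2 * x%:num.
  have : e / 2 * (2 / e * (C + M + e / 2 * D)) <= e / 2 * x%:num.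
    by rewrite ler_pM2l // divr_gt0.
  by rewrite mulrA (_ : e / 2 * (2 / e) = 1) ?mul1r //; field; rewrite gt_eqF.
have := ler_distD (v (u x))%:num (v (f (u x)))%:num x%:num.
have h10 : `|(v (u x))%:num - x%:num| <= M := hM x.
by lra.
Qed.

Lemma asymp_id_inv f u v : bounded_dist (u \o v) id -> asymp_id u -> asymp_id v.
Proof.
move=> [M hM] /asymp_idP hu; apply/asymp_idP => e e0.
have [L [D [L0 D0 hL]]] := qi_growth u.
pose d : R := Num.min (e / 4) (1 / 2).
have d0 : 0 < d by rewrite lt_min; apply/andP; split; lra.
have d1 : d <= e / 4 by rewrite ge_min lexx.
have d2 : d <= 1 / 2 by rewrite ge_min lexx orbT.
have [A hA] := hu d d0.
exists (Num.max (L * (A + D) + M) (2 / e * (M + e / 2 * M))) => x.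
rewrite ge_max => /andP[h1 h2].
have h3 : `|(u (v x))%:num - x%:num| <= M by apply: hM.
have M0 : 0 <= M by apply: le_trans h3.
have [h4 h5] := hL (v x).
have := h3; rewrite ler_distl => /andP[h6 h7].
have h8 : A <= (v x)%:num.
  have : L * (A + D) <= L * ((v x)%:num + D) by lra.
  by rewrite ler_pM2l // lerD2r.
have h9 := hA _ h8.
have v0 : 0 <= (v x)%:num by [].
have := ler_distD (u (v x))%:num (v x)%:num x%:num.
rewrite (distrC (v x)%:num (u (v x))%:num).
have h10 : (v x)%:num <= 2 * (x%:num + M).
  by have := h9; rewrite ler_distl => /andP[h11 _]; nra.
have h11 : M + e / 2 * M <= e / 2 * x%:num.
  have : e / 2 * (2 / e * (M + e / 2 * M)) <= e / 2 * x%:num.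
    by rewrite ler_pM2l // divr_gt0.
  by rewrite mulrA (_ : e / 2 * (2 / e) = 1) ?mul1r //; field; rewrite gt_eqF.
have : d * (v x)%:num <= e / 4 * (2 * (x%:num + M)) by rewrite ler_pM // ltW.
by lra.
Qed.

Lemma H_setE u : qi_class u \in H_set <-> asymp_id u.
Proof.
rewrite inE; split=> [[f hf /qi_classE fu]|hu]; last by exists u.
exact: asymp_id_bounded fu hf.
Qed.

Lemma H_group : subgroup H_set.
Proof.
split.
  apply/H_setE/asymp_idP => e e0; exists 0 => x _.
  by rewrite subrr normr0 mulr_ge0 // ltW.
move=> x y; rewrite -(qi_class_repr x) -(qi_class_repr y).
move=> /H_setE hx /H_setE hy.
have [v [_ hv]] := qi_inv_ex (repr y).
rewrite (qi_classV hv) -qi_classM; apply/H_setE/asymp_id_comp => //.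
exact: asymp_id_inv hv hy.
Qed.

Lemma H_conj (x y : QI) : x \in H_set -> (x ^ y)%g \in H_set.
Proof.
rewrite -(qi_class_repr x) -(qi_class_repr y) => /H_setE hx.
have [v [hv1 hv2]] := qi_inv_ex (repr y).
rewrite conjgE (qi_classV hv2).
rewrite -(qi_classM (repr x) (repr y)) -qi_classM; apply/H_setE.
exact: (@asymp_id_conj (repr x) (repr y) v hv1 hx).
Qed.

Definition H : normal_subgroup QI := NormalSubgroup H_group H_conj.

End QuasiIsometries.

(* Main.v *)
Require Import Defs.
From mathcomp Require Import all_boot all_order all_algebra.
From mathcomp Require Import all_classical all_reals all_analysis.
From mathcomp Require Import interval_inference ring lra zify.

Set Implicit Arguments.
Unset Strict Implicit.
Unset Printing Implicit Defensive.

Import Order.TTheory GRing.Theory Num.Theory.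

(** In [QI(R_+)/H] two classes [a] and [b] are exhibited with
      [b ^+ 3 = a ^+ 4], [(b * a) ^+ 5 = a ^+ 12] and [a <> 1].
    A homomorphism [phi] from the group generated by [a] and [b] to the integers
    then satisfies [3 phi(b) = 4 phi(a)] and
    [5 (phi(a) + phi(b)) = 12 phi(a)]; this linear system is nonsingular, so
    [phi] vanishes ([not_locally_indicable_pentagon]).

    The relations come from Thompson's group T of homeomorphisms of the circle.
    The circle is taken to be the quotient of the half-line of positive reals
    by [z : x |-> 16 x], so that an increasing homeomorphism of it commuting with
    [z] is the same as a lift of an orientation-preserving homeomorphism of the
    circle; piecewise linear ones are bi-Lipschitz, hence quasi-isometries.
    T contains an element [alpha] of order 4, rotating a square with vertices
    on the circle, and an element [beta] of order 3, rotating one of the two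
    triangles that a diagonal cuts from the square, and the product has order 5:
    this is the pentagon relation.  Here the square is 1, 2, 4, 8 and the
    triangle is 1, 4, 8.  The lift of [alpha] is the dilation by 2, and the lift
    of [beta] is [turn].  The lifts have rotation numbers 1/4, 1/3 and 3/5, that
    is, [a ^+ 4 = z], [b ^+ 3 = z] ([turn_cube]) and [(b * a) ^+ 5 = z ^+ 3]
    ([turn_double_fifth]).  Since 1/4 + 1/3 differs from 3/5, a homomorphism to
    the integers has to kill [z], and then [a] and [b].

    Finally [a <> 1] because [2 x / x] does not tend to 1. *)

(** * Two relations that leave no homomorphism to the integers *)

Section Obstruction.
Local Open Scope group_scope.

Section HomToInt.
Variables (G : groupType) (K : set G) (phi : G -> int).
Hypothesis K_group : subgroup K.
Hypothesis phiM : {in K &, forall x y, phi (x * y) = (phi x + phi y)%R}.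

Lemma hom_one : phi 1 = 0%R.
Proof.
have K1 : 1 \in K by case: K_group.
by have := phiM K1 K1; rewrite mulg1; lia.
Qed.

Lemma subgroupX x n : x \in K -> x ^+ n \in K.
Proof.
move=> Kx; elim: n => [|n IHn]; first by case: K_group.
by rewrite expgS; apply: group_closedM K_group _ _ Kx IHn.
Qed.

Lemma homX x n : x \in K -> phi (x ^+ n) = (n%:Z * phi x)%R.
Proof.
move=> Kx; elim: n => [|n IHn]; first by rewrite expg0 hom_one; lia.
by rewrite expgS phiM ?subgroupX // IHn; lia.
Qed.

(** A homomorphism that kills a set of generators of [K] is trivial on [K],
    because its kernel is then a subgroup containing them. *)
Lemma hom_ker_group : subgroup [set x | x \in K /\ phi x = 0%R]%classic.
Proof.
have [K1 Kdiv] := K_group; split=> [|x y].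
  by rewrite inE; split; last exact: hom_one.
rewrite !inE => -[Kx x0] [Ky y0]; have Kxy := Kdiv _ _ Kx Ky; split=> //.
by have := phiM Kxy Ky; rewrite mulgVK; lia.
Qed.

End HomToInt.

Lemma gen_subgroup_group (G : groupType) (s : seq G) :
  subgroup (gen_subgroup s).
Proof.
split=> [|x y]; first by rewrite inE => L [[L1 _] _]; move: L1; rewrite inE.
rewrite !inE => Kx Ky L [Lgrp Ls].
by apply/set_mem/(proj2 Lgrp); apply/mem_set; [apply: Kx | apply: Ky].
Qed.

Lemma mem_gen_subgroup (G : groupType) (s : seq G) x :
  x \in s -> x \in gen_subgroup s.
Proof. by move=> sx; rewrite inE => L [_]; apply. Qed.

(** For [x = phi a] and [y = phi b] the relations become [3 y = 4 x] and
    [5 y = 7 x], a homogeneous linear system of determinant 1: the subgroup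
    generated by [a] and [b] is perfect. *)
Lemma not_locally_indicable_pentagon (G : groupType) (a b : G) :
  a <> 1 -> b ^+ 3 = a ^+ 4 -> (b * a) ^+ 5 = a ^+ 12 -> ~ locally_indicable G.
Proof.
move=> a1 b3 ba5 locG; set s := [:: a; b]; have Kgrp := gen_subgroup_group s.
have Ka : a \in gen_subgroup s by apply: mem_gen_subgroup; rewrite inE eqxx.
have Kb : b \in gen_subgroup s by apply: mem_gen_subgroup; rewrite !inE eqxx orbT.
have [||phi [phiM [x Kx /eqP[]]]] := locG _ Kgrp; first by exists s.
  by move=> K1; apply: a1; move: Ka; rewrite K1 inE.
have Kba : b * a \in gen_subgroup s by apply: group_closedM Kgrp _ _ Kb Ka.
have e1 := congr1 phi b3; have e2 := congr1 phi ba5.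
move: e1 e2; rewrite !(homX Kgrp phiM) // phiM // => e1 e2.
have [a0 b0] : phi a = 0%R /\ phi b = 0%R by split; lia.
move: Kx; rewrite inE => /(_ [set y | y \in gen_subgroup s /\ phi y = 0%R]%classic).
case=> //; split; first exact: hom_ker_group.
by move=> y; rewrite /= !in_cons in_nil orbF => /orP[] /eqP->.
Qed.

Lemma coset_classX (G : groupType) (N : normal_subgroup G) (x : G) n :
  coset_class N (x ^+ n) = coset_class N x ^+ n.
Proof.
elim: n => [|n IHn]; first by rewrite !expg0.
by rewrite !expgS coset_classM IHn.
Qed.

Lemma coset_class_eq1 (G : groupType) (N : normal_subgroup G) (x : G) :
  coset_class N x = 1 -> x \in (N : set G).
Proof. by move/esym/coset_classE; rewrite /coset_eq invg1 mul1g. Qed.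

End Obstruction.

(** * Quasi-isometries of the half-line *)

Local Open Scope ring_scope.

Section QuasiIsometries.
Variable R : realType.
Implicit Types (x y u : R) (f g : {nonneg R} -> {nonneg R}).

(** Quasi-isometries grow at most linearly, so each one is bounded on a bounded
    interval.  The relations thus need checking only away from 0. *)
Lemma bounded_dist_eventually f g (A : R) : quasi_isometry f -> quasi_isometry g ->
  (forall x : {nonneg R}, A <= x%:num -> f x = g x) -> bounded_dist f g.
Proof.
move=> qf qg fg; have [L [D [L0 _ hf]]] := qi_growth (QiMap qf).
have [M [E [M0 _ hg]]] := qi_growth (QiMap qg).
exists (Num.max 0 (L * (A + D) + M * (A + E))) => x; rewrite le_max.
have [/fg->|xA] := leP A x%:num; first by rewrite subrr normr0 lexx.
apply/orP; right; have [_ hfx] := hf x; have [_ hgx] := hg x.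
have f0 : 0 <= (f x)%:num by []. have g0 : 0 <= (g x)%:num by [].
apply: (le_trans (ler_normB _ _)); rewrite !ger0_norm // lerD //.
  by apply: (le_trans hfx); rewrite ler_pM2l // lerD2r ltW.
by apply: (le_trans hgx); rewrite ler_pM2l // lerD2r ltW.
Qed.

Lemma quasi_isometry_iter f n : quasi_isometry f -> quasi_isometry (iter n f).
Proof.
move=> qf; elim: n => [|n IHn]; first exact: quasi_isometry_id.
exact: (quasi_isometry_comp qf IHn).
Qed.

Lemma qi_classX (w : qi_map R) n :
  (qi_class w ^+ n)%g = qi_class (QiMap (quasi_isometry_iter n (qi_mapP w))).
Proof.
elim: n => [|n IHn]; first by apply/qi_classE/bounded_dist_refl.
by rewrite expgS IHn -qi_classM; apply/qi_classE/bounded_dist_refl.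
Qed.

Definition dilation (x : {nonneg R}) : {nonneg R} := (2 * x%:num)%:nng.

Lemma quasi_isometry_dilation : quasi_isometry dilation.
Proof.
exists 2, 0; split=> [||x y|y]; [lra | lra | |].
  rewrite /= -mulrBr normrM (ger0_norm (ler0n _ 2)).
  by have := normr_ge0 (x%:num - y%:num); lra.
exists (y%:num / 2)%:nng => /=.
by rewrite (_ : _ - _ = 0) ?normr0 //; field.
Qed.

Lemma iter_dilation n (x : {nonneg R}) : (iter n dilation x)%:num = 2 ^+ n * x%:num.
Proof.
elim: n => [|n IHn]; first by rewrite mul1r.
by rewrite iterS /= IHn exprS mulrA.
Qed.

(** * The piecewise linear lift of the rotation of order 3 *)

(** For [x >= 1], the power of 16 by which [x] has to be divided to fall into the
    fundamental domain [[1, 16)] of [z].  On [[0, 1)] the value is 1, so that the first affine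
    piece of [turn] extends down to 0. *)
Definition level x : R := 16 ^+ trunc_log 16 (Num.truncn x).

Lemma level_eq n x : 16 ^+ n <= x < 16 ^+ n.+1 -> level x = 16 ^+ n.
Proof.
move=> /andP[lx xu]; have x0 : 0 <= x by apply: le_trans lx; rewrite exprn_ge0.
congr (_ ^+ _); apply: trunc_log_eq => //.
by rewrite truncn_ge_nat // truncn_lt_nat // !natrX lx xu.
Qed.

Lemma level_bounds x : 1 <= x -> level x <= x < 16 * level x.
Proof.
move=> x1; have x0 : 0 <= x by lra.
have t0 : (0 < Num.truncn x)%N by rewrite truncn_gt0.
have /= := trunc_log_bounds (isT : (1 < 16)%N) t0.
by rewrite truncn_ge_nat // truncn_lt_nat // !natrX -exprS.
Qed.

Lemma level_lt1 x : 0 <= x < 1 -> level x = 1.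
Proof.
move=> /andP[x0 x1]; rewrite /level (_ : Num.truncn x = 0%N) ?trunc_log0 //.
by apply/eqP; rewrite truncn_eq // x0.
Qed.

Lemma level_ge1 x : 1 <= level x.
Proof. by rewrite exprn_ege1 ?ler1n. Qed.

Lemma lt_level x : 0 <= x -> x < 16 * level x.
Proof.
move=> x0; have [/level_bounds/andP[]//|x1] := leP 1 x.
by rewrite level_lt1 ?x0 //; lra.
Qed.

(** Bounds on the increments of [turn] reduce to a single [turn_piece] in the
    first case; in the second they pass through the points [16 * level x] and
    [level y], which separate [x] from [y]. *)
Lemma level_mono x y : 0 <= x <= y ->
  level x = level y \/ 16 * level x <= level y <= y.
Proof.
move=> /andP[x0 xy]; have y0 := le_trans x0 xy.
have t : (trunc_log 16 (Num.truncn x) <= trunc_log 16 (Num.truncn y))%N.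
  by apply: leq_trunc_log; apply: le_truncn.
move: t; rewrite leq_eqVlt => /orP[/eqP e|lt_t]; first by left; congr (_ ^+ _).
have le16 : 16 * level x <= level y by rewrite -exprS ler_weXn2l ?ler1n.
right; rewrite le16 /=; have [/level_bounds/andP[]//|y1] := leP 1 y.
by have := level_ge1 x; have := @level_lt1 y; rewrite y0 y1 => /(_ isT); lra.
Qed.

(** Rotating the triangle [u, 4 u, 8 u] maps [[u, 4 u]] to [[4 u, 8 u]],
    [[4 u, 8 u]] to [[8 u, 16 u]] and [[8 u, 16 u]] to [[16 u, 64 u]]; the three
    terms are the affine maps doing this.  Their slopes 4/3, 2, 6 increase, so
    the map is convex and equal to their maximum, which makes its
    continuity automatic. *)
Definition turn_piece u x : R :=
  Num.max (4 * (x + 2 * u) / 3) (Num.max (2 * x) (6 * x - 32 * u)).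

Lemma turn_pieceP u x : 0 <= u ->
  [\/ x <= 4 * u /\ turn_piece u x = 4 * (x + 2 * u) / 3,
      4 * u <= x <= 8 * u /\ turn_piece u x = 2 * x |
      8 * u <= x /\ turn_piece u x = 6 * x - 32 * u].
Proof.
move=> u0; rewrite /turn_piece; have [h1|h1] := leP x (4 * u).
  by apply: Or31; split=> //; apply: max_l; rewrite ge_max; lra.
have [h2|h2] := leP x (8 * u).
  by apply: Or32; split; [lra | rewrite max_r max_l //; lra].
by apply: Or33; split; [lra | rewrite (max_r (x := 2 * x)) ?max_r //; lra].
Qed.

Lemma turn_piece_slope u x y : 0 <= u -> x <= y ->
  4 / 3 * (y - x) <= turn_piece u y - turn_piece u x <= 6 * (y - x).
Proof.
move=> u0 xy; have := turn_pieceP x u0; have := turn_pieceP y u0.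
by move=> [] [hy ->] [] [hx ->]; lra.
Qed.

Definition turn x := turn_piece (level x) x.

Lemma turn_ge0 x : 0 <= x -> 0 <= turn x.
Proof.
by move=> x0; have := level_ge1 x; have := @turn_pieceP (level x) x; rewrite /turn;
  move=> h l1; case: h => [|[_ ->]|[h ->]|[h ->]]; lra.
Qed.

(** When [x] and [y] lie in different fundamental domains, the bounds for a
    single [turn_piece] are added along [x], the end [16 u] of the domain of [x], the
    start [v] of the domain of [y], and [y].  From [16 u] to [v] the map [turn]
    goes from [64 u] to [4 v], a mean slope of 4. *)
Lemma turn_slope x y : 0 <= x <= y ->
  4 / 3 * (y - x) <= turn y - turn x <= 6 * (y - x).
Proof.
move=> /[dup] /andP[x0 xy] /level_mono hl; have x1 := level_ge1 x.
have y1 := level_ge1 y; rewrite /turn; case: hl => [->|/andP[h1 h2]].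
  by apply: turn_piece_slope => //; lra.
have := lt_level x0; set u := level x in x1 h1 *; set v := level y in y1 h1 h2 *.
move=> xu; have := @turn_piece_slope u x (16 * u); have := @turn_piece_slope v v y.
have : turn_piece v v = 4 * v by case: (@turn_pieceP v v) => [|[]|[]|[]]; lra.
have : turn_piece u (16 * u) = 64 * u.
  by case: (@turn_pieceP u (16 * u)) => [|[]|[]|[]]; lra.
by move=> -> -> /(_ ltac:(lra) ltac:(lra)) hv /(_ ltac:(lra) ltac:(lra)); lra.
Qed.

Lemma turnE n x : 16 ^+ n <= x < 16 * 16 ^+ n -> turn x = turn_piece (16 ^+ n) x.
Proof. by rewrite -exprS /turn => /level_eq->. Qed.

Lemma turn_low n x : 16 ^+ n <= x < 4 * 16 ^+ n ->
  turn x = 4 * (x + 2 * 16 ^+ n) / 3.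
Proof.
move=> h; rewrite (@turnE n); last by lra.
by have [|[]|[]|[]] := @turn_pieceP (16 ^+ n) x; lra.
Qed.

Lemma turn_mid n x : 4 * 16 ^+ n <= x < 8 * 16 ^+ n -> turn x = 2 * x.
Proof.
move=> h; rewrite (@turnE n); last by lra.
by have [|[]|[]|[]] := @turn_pieceP (16 ^+ n) x; lra.
Qed.

Lemma turn_high n x : 8 * 16 ^+ n <= x < 16 * 16 ^+ n ->
  turn x = 6 * x - 32 * 16 ^+ n.
Proof.
move=> h; rewrite (@turnE n); last by lra.
by have [|[]|[]|[]] := @turn_pieceP (16 ^+ n) x; lra.
Qed.

(** [turn] sends each of the three intervals of a fundamental domain affinely to
    the next, so its cube is affine on each of them, and it agrees with [z] at
    the end points. *)
Lemma turn_cube x : 1 <= x -> turn (turn (turn x)) = 16 * x.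
Proof.
move=> /level_bounds/andP[]; rewrite /level; move: (trunc_log _ _) => n h1 h2.
have n1 : 16 ^+ n.+1 = 16 * 16 ^+ n :> R by rewrite exprS.
have [h3|h3] := ltP x (4 * 16 ^+ n).
  have e1 := @turn_low n x ltac:(lra).
  have e2 := @turn_mid n (turn x) ltac:(lra).
  by have e3 := @turn_high n (turn (turn x)) ltac:(lra); lra.
have [h4|h4] := ltP x (8 * 16 ^+ n).
  have e1 := @turn_mid n x ltac:(lra).
  have e2 := @turn_high n (turn x) ltac:(lra).
  by have e3 := @turn_low n.+1 (turn (turn x)) ltac:(lra); lra.
have e1 := @turn_high n x ltac:(lra).
have e2 := @turn_low n.+1 (turn x) ltac:(lra).
by have e3 := @turn_mid n.+1 (turn (turn x)) ltac:(lra); lra.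
Qed.

(** The pentagon relation.  The points 1, 2, 4, 16/3, 8 cut the circle into five
    intervals on each of which [x |-> turn (2 * x)] is affine.  It permutes the
    intervals cyclically, in the order
      [[1, 2) -> [16/3, 8) -> [2, 4) -> [8, 16) -> [4, 16/3) -> [1, 2)],
    so its fifth power is affine on each of them and multiplies the end points
    by a power of 16.  Along the whole cycle the exponent of 16 grows by 3.  Each
    case below follows the cycle starting from one of the intervals. *)
Lemma turn_double_fifth x : 1 <= x ->
  turn (2 * turn (2 * turn (2 * turn (2 * turn (2 * x))))) = 4096 * x.
Proof.
move=> /level_bounds/andP[]; rewrite /level; move: (trunc_log _ _) => n h1 h2.
have n1 : 16 ^+ n.+1 = 16 * 16 ^+ n :> R by rewrite exprS.
have n2 : 16 ^+ n.+2 = 16 * 16 ^+ n.+1 :> R by rewrite exprS.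
have n3 : 16 ^+ n.+3 = 16 * 16 ^+ n.+2 :> R by rewrite exprS.
pose q y := turn (2 * y); rewrite -![turn (2 * _)]/(q _).
have [h3|h3] := ltP x (2 * 16 ^+ n).
  have e1 : q x = _ := @turn_low n (2 * x) ltac:(lra).
  have e2 : q (q x) = _ := @turn_high n (2 * (q x)) ltac:(lra).
  have e3 : q (q (q x)) = _ := @turn_mid n.+1 (2 * (q (q x))) ltac:(lra).
  have e4 : q (q (q (q x))) = _ := @turn_low n.+2 (2 * (q (q (q x)))) ltac:(lra).
  by have e5 : q (q (q (q (q x)))) = _ := @turn_high n.+2 (2 * (q (q (q (q x))))) ltac:(lra); lra.
have [h4|h4] := ltP x (4 * 16 ^+ n).
  have e1 : q x = _ := @turn_mid n (2 * x) ltac:(lra).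
  have e2 : q (q x) = _ := @turn_low n.+1 (2 * (q x)) ltac:(lra).
  have e3 : q (q (q x)) = _ := @turn_high n.+1 (2 * (q (q x))) ltac:(lra).
  have e4 : q (q (q (q x))) = _ := @turn_low n.+2 (2 * (q (q (q x)))) ltac:(lra).
  by have e5 : q (q (q (q (q x)))) = _ := @turn_high n.+2 (2 * (q (q (q (q x))))) ltac:(lra); lra.
have [h5|h5] := ltP (3 * x) (16 * 16 ^+ n).
  have e1 : q x = _ := @turn_high n (2 * x) ltac:(lra).
  have e2 : q (q x) = _ := @turn_low n.+1 (2 * (q x)) ltac:(lra).
  have e3 : q (q (q x)) = _ := @turn_high n.+1 (2 * (q (q x))) ltac:(lra).
  have e4 : q (q (q (q x))) = _ := @turn_mid n.+2 (2 * (q (q (q x)))) ltac:(lra).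
  by have e5 : q (q (q (q (q x)))) = _ := @turn_low n.+3 (2 * (q (q (q (q x))))) ltac:(lra); lra.
have [h6|h6] := ltP x (8 * 16 ^+ n).
  have e1 : q x = _ := @turn_high n (2 * x) ltac:(lra).
  have e2 : q (q x) = _ := @turn_mid n.+1 (2 * (q x)) ltac:(lra).
  have e3 : q (q (q x)) = _ := @turn_low n.+2 (2 * (q (q x))) ltac:(lra).
  have e4 : q (q (q (q x))) = _ := @turn_high n.+2 (2 * (q (q (q x)))) ltac:(lra).
  by have e5 : q (q (q (q (q x)))) = _ := @turn_low n.+3 (2 * (q (q (q (q x))))) ltac:(lra); lra.
have e1 : q x = _ := @turn_low n.+1 (2 * x) ltac:(lra).
have e2 : q (q x) = _ := @turn_high n.+1 (2 * (q x)) ltac:(lra).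
have e3 : q (q (q x)) = _ := @turn_low n.+2 (2 * (q (q x))) ltac:(lra).
have e4 : q (q (q (q x))) = _ := @turn_high n.+2 (2 * (q (q (q x)))) ltac:(lra).
by have e5 : q (q (q (q (q x)))) = _ := @turn_mid n.+3 (2 * (q (q (q (q x))))) ltac:(lra); lra.
Qed.

Definition turn_map (x : {nonneg R}) : {nonneg R} := NngNum (turn_ge0 (ge0 x)).

Lemma quasi_isometry_turn : quasi_isometry turn_map.
Proof.
(* No slope exceeds 6, and [turn 0 = 8 / 3] is within 16 of every point
   below 16. *)
exists 6, 16; split=> [||x y|y]; [lra | lra | |].
  wlog xy : x y / x%:num <= y%:num => [hw|].
    have [|/ltW] := leP x%:num y%:num; first exact: hw.
    by move=> /hw; rewrite (distrC y%:num) (distrC (turn_map y)%:num).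
  have /andP[h1 h2] : 4 / 3 * (y%:num - x%:num) <= turn y%:num - turn x%:num
    <= 6 * (y%:num - x%:num) by apply: turn_slope; rewrite xy ge0.
  by rewrite /= (distrC x%:num) (distrC (turn x%:num)) !ger0_norm; lra.
have [y16|y16] := leP 16 y%:num.
  have x0 : 0 <= y%:num / 16 by [].
  (* The inverse of [turn] is [z^-1 \o turn \o turn] on large points. *)
  exists (turn_map (turn_map (NngNum x0))) => /=.
  rewrite turn_cube; last by lra.
  by rewrite (_ : _ - _ = 0) ?normr0; [lra | field].
exists (NngNum (lexx 0)) => /=; rewrite /turn level_lt1 ?lexx ?ltr01 //.
have y0 : 0 <= y%:num by [].
by case: (@turn_pieceP 1 0) => [|[_ ->]|[]|[]]; rewrite ?ler_distl; lra.
Qed.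

Definition qi_dilation : qi_map R := QiMap quasi_isometry_dilation.
Definition qi_turn : qi_map R := QiMap quasi_isometry_turn.

Lemma qi_turnX3 : (qi_class qi_turn ^+ 3 = qi_class qi_dilation ^+ 4)%g.
Proof.
rewrite !qi_classX; apply/qi_classE/(@bounded_dist_eventually _ _ 1).
- exact: qi_mapP.
- exact: qi_mapP.
move=> x x1; apply: val_inj; rewrite [RHS](iter_dilation 4 x) /= turn_cube //; lra.
Qed.

Lemma qi_turn_dilationX5 :
  ((qi_class qi_turn * qi_class qi_dilation) ^+ 5 =
   qi_class qi_dilation ^+ 12)%g.
Proof.
rewrite -qi_classM !qi_classX.
apply/qi_classE/(@bounded_dist_eventually _ _ 1); [exact: qi_mapP.. |].
move=> x x1; apply: val_inj; rewrite [RHS](iter_dilation 12 x) /=.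
by rewrite turn_double_fifth //; lra.
Qed.

Lemma qi_dilation_notin_H : qi_class qi_dilation \notin (H R : set (QI R)).
Proof.
apply/negP => /H_setE/asymp_idP/(_ (1 / 2) ltac:(lra)) [A hA].
have x0 : 0 <= Num.max A 1 by rewrite le_max ler01 orbT.
have := hA (NngNum x0); rewrite /= le_max lexx => /(_ isT).
have : 1 <= Num.max A 1 by rewrite le_max lexx orbT.
by move: (Num.max A 1) => y y1; rewrite ger0_norm; lra.
Qed.

End QuasiIsometries.

Theorem theorem1p3 (R : realType) : ~ locally_indicable (quotient_group (H R)).
Proof.
apply: (@not_locally_indicable_pentagon _
  (coset_class (H R) (qi_class (qi_dilation R)))
  (coset_class (H R) (qi_class (qi_turn R)))).
- by move=> /coset_class_eq1; apply/negP/qi_dilation_notin_H.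
- by rewrite -!coset_classX qi_turnX3.
- by rewrite -coset_classM -!coset_classX qi_turn_dilationX5.
Qed.
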